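(* Let $I\subset \mathbb{R}$ be an interval and let $\mu$ be a finite positive measure on the Borel sigma-field of $I$. Let $n\geq 1$ and let $x_k : I\to\mathbb{R}$, $k=1,\ldots,n$, be continuous functions on $I$, integrable on $I$ with respect to the measure $\mu$. Then there exist points $t_1,\ldots,t_n$ in $I$ and non-negative numbers $\lambda_1,\ldots,\lambda_n$, with $\sum_{i=1}^n \lambda_i = \mu(I)$, such that \[ \int_{I} x_k(t)\, d\mu(t) = \sum_{i=1}^n \lambda_i x_k(t_i),\qquad k=1,\ldots,n. \]
   Context: The interval $I$ is arbitrary: it may be open, closed, half-open, bounded or unbounded. The functions $x_k$ are not assumed bounded. The points $t_1,\ldots,t_n$ are not required to be distinct. *)

(* Defs.v *)
From mathcomp Require Export all_boot all_order all_algebra.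
From mathcomp Require Export all_classical all_reals all_analysis.
Export Order.TTheory GRing.Theory Num.Theory.
Export numFieldNormedType.Exports.

Global Set Implicit Arguments.
Global Unset Strict Implicit.
Global Unset Printing Implicit Defensive.

#[global] Open Scope classical_set_scope.
#[global] Open Scope ring_scope.

(* Conventions: a finite Borel measure on an interval I is given as a Borel
   measure mu on R with mu I < +oo; only its values on Borel subsets of I are
   ever used, and every finite Borel measure on I arises in this way (extend it
   by A |-> mu (A `&` I)). Likewise a function on I is the restriction to I of
   a function R -> R, constrained only on I; its values and continuity outside
   I are irrelevant. *)

(* Main.v *)
From HB Require Import structures.
Require Import Defs.
From mathcomp Require Import measurable_realfun ring.

(** After subtracting from each function its mean, the claim becomes: if all
    the integrals of the [x k] over [I] vanish and [mu I] is positive, then the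
    origin of [R^n] is a convex combination of at most [n] points of the curve
    [t |-> (x k t)_k]. Rescaling the weights to total mass [mu I] then gives
    the quadrature formula. This has two independent halves.

    Measure theory ([zero_combination_of_integral_eq0]): the origin lies in the
    convex hull itself, and not only in its closure, of the values of any
    integrable family with zero integrals, for any nonzero finite measure. The
    usual proof separates the origin from the hull by a hyperplane; here
    separation is replaced by an induction on [n] that changes the measure
    space. Let [f] be the first function. If [f] vanishes almost everywhere,
    restrict to its zero set and forget it. Otherwise pair each point [s] where
    [f] is nonnegative with each point [t] where it is negative: the segment
    between the two values contains a point whose first coordinate is zero,
    namely a positive multiple of [f s * x k t - x k s * f t]. These functions
    of [(s, t)] have zero integrals for the product measure by Fubini, and the
    first of them is identically zero, so the induction applies to the
    remaining ones on the product space. A combination of pairs unfolds into a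
    combination of points of the original space.

    Geometry ([zero_combination_exchange]): a combination of [m + 1] points can
    be rewritten with [m] points as soon as [n <= m]. When the points other
    than the first are linearly dependent this is the step of Caratheodory's
    theorem ([zero_combination_dependent]). The remaining case, which lowers
    Caratheodory's [n + 1] to [n], uses that the curve is connected: the points
    other than the first form a basis, and in the opposite basis the
    coordinates of the curve are all positive at the first point, while one of
    them is negative at another point. In between ([common_zero_of_min]) the
    least coordinate vanishes; the point of the curve found there replaces the
    first point and makes one of the others superfluous. *)

(** * Convex combinations equal to zero *)

Definition zero_combination (R : realType) (T : Type) (D : set T) (n : nat)
    (x : 'I_n -> T -> R) (J : finType) : Prop :=
  exists (p : J -> T) (w : J -> R),
    [/\ forall j, D (p j), forall j, 0 <= w j, \sum_j w j = 1 &
        forall k, \sum_j w j * x k (p j) = 0].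

Lemma zero_combination_normalize (R : realType) (T : Type) (D : set T)
    (n : nat) (x : 'I_n -> T -> R) (J : finType) (p : J -> T) (w : J -> R) :
  (forall j, D (p j)) -> (forall j, 0 <= w j) -> (exists j, 0 < w j) ->
  (forall k, \sum_j w j * x k (p j) = 0) ->
  zero_combination D x J.
Proof.
move=> Dp w0 [j0 wj0] wx0; set W := \sum_j w j.
have W0 : 0 < W.
  by rewrite /W (bigD1 j0)//= ltr_pwDl// sumr_ge0.
exists p, (fun j => W^-1 * w j); split => [//|j||k].
- by rewrite mulr_ge0// invr_ge0 ltW.
- by rewrite -mulr_sumr mulVf// gt_eqF.
- under eq_bigr do rewrite -mulrA.
  by rewrite -mulr_sumr wx0 mulr0.
Qed.

Lemma exists_pos_weight (R : realType) (J : finType) (w : J -> R) :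
  \sum_j w j = 1 -> exists j, 0 < w j.
Proof.
move=> w1; apply: contrapT => /forallNP wN.
have : \sum_j w j <= 0 by apply: sumr_le0 => j _; rewrite leNgt; exact/negP/wN.
by rewrite w1 ler10.
Qed.

(** A positive weight is required because a point of weight zero can only be
    deleted if the remaining weights can still be normalized to total 1. *)
Lemma zero_combination_prune (R : realType) (T : Type) (D : set T) (n m : nat)
    (x : 'I_n -> T -> R) (p : 'I_m.+1 -> T) (w : 'I_m.+1 -> R) :
  (forall j, D (p j)) -> (forall j, 0 <= w j) -> (exists j, 0 < w j) ->
  (forall k, \sum_j w j * x k (p j) = 0) ->
  (exists j, w j = 0) ->
  zero_combination D x 'I_m.
Proof.
move=> Dp w0 [j0 wj0] wx0 [i wi0].
apply: (@zero_combination_normalize _ _ _ _ _ _ (p \o lift i) (w \o lift i)).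
- by move=> j; exact: Dp.
- by move=> j; exact: w0.
- have [j j0E|j0E] := unliftP i j0; first by exists j; rewrite /= -j0E.
  by move: wj0; rewrite j0E wi0 ltxx.
- by move=> k; rewrite -[RHS](wx0 k) [RHS](bigD1_ord i)//= wi0 mul0r add0r.
Qed.

Lemma zero_combination_pad (R : realType) (T : Type) (D : set T) (n m : nat)
    (x : 'I_n -> T -> R) :
  D !=set0 ->
  zero_combination D x 'I_m -> zero_combination D x 'I_m.+1.
Proof.
move=> [t0 Dt0] [p [w [Dp w0 w1 wx0]]].
exists (fun i => if unlift ord0 i is Some j then p j else t0).
exists (fun i => if unlift ord0 i is Some j then w j else 0); split.
- by move=> i; case: unliftP.
- by move=> i; case: unliftP.
- rewrite big_ord_recl unlift_none add0r -[RHS]w1.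
  by apply: eq_bigr => j _; rewrite liftK.
- move=> k; rewrite big_ord_recl unlift_none mul0r add0r -[RHS](wx0 k).
  by apply: eq_bigr => j _; rewrite liftK.
Qed.

(** The step of Caratheodory's theorem: a multiple of the linear relation [v] is
    subtracted from the weights until one of them vanishes. The relation leaves
    out the first point, so that the first weight stays positive. *)
Lemma zero_combination_dependent (R : realType) (T : Type) (D : set T)
    (n m : nat) (x : 'I_n -> T -> R) (p : 'I_m.+1 -> T) (w : 'I_m.+1 -> R)
    (v : 'I_m -> R) :
  (forall j, D (p j)) -> (forall j, 0 < w j) ->
  (forall k, \sum_j w j * x k (p j) = 0) ->
  (forall k, \sum_j v j * x k (p (lift ord0 j)) = 0) ->
  (exists j, v j != 0) ->
  zero_combination D x 'I_m.
Proof.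
move=> Dp w0 wx0; wlog [j0 vj0] : v / exists j, 0 < v j.
  move=> wl vx0 [j vj]; have [vp|vn] := ltP 0 (v j).
    by apply: (wl v) => //; exists j.
  apply: (wl (fun j => - v j)).
  - by exists j; rewrite oppr_gt0 lt_neqAle vj.
  - by move=> k; under eq_bigr do rewrite mulNr; rewrite sumrN vx0 oppr0.
  - by exists j; rewrite oppr_eq0.
move=> vx0 _.
have [j1 vj1 jmin] := @arg_minP _ _ _ j0 (fun j => 0 < v j)
  (fun j => w (lift ord0 j) / v j) vj0.
(* The largest multiple of [v] that keeps all the weights nonnegative. *)
set c := w (lift ord0 j1) / v j1.
have c0 : 0 <= c by rewrite divr_ge0// ltW.
pose v' i := if unlift ord0 i is Some j then v j else 0.
apply: (@zero_combination_prune _ _ _ _ _ _ p (fun i => w i - c * v' i)) => //.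
- move=> i; rewrite /v' subr_ge0; case: unliftP => [j|] ->; last first.
    by rewrite mulr0 ltW.
  have [vj|vj] := ltP 0 (v j); first by rewrite -ler_pdivlMr// jmin.
  by apply: (@le_trans _ _ 0); [exact: mulr_ge0_le0 | exact: ltW].
- by exists ord0; rewrite /v' unlift_none mulr0 subr0.
- move=> k; under eq_bigr do rewrite mulrBl -mulrA.
  rewrite sumrB wx0 sub0r -mulr_sumr big_ord_recl /v' unlift_none mul0r add0r.
  under eq_bigr do rewrite liftK.
  by rewrite vx0 mulr0 oppr0.
- by exists (lift ord0 j1); rewrite /v' liftK /c divfK ?subrr// gt_eqF.
Qed.

(** * Reducing the number of points on a curve *)

(** The intermediate value theorem, applied to the minimum of the functions. *)
Lemma common_zero_of_min (R : realType) (I : set R) (m : nat)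
    (a : 'I_m -> R -> R) (s t : R) (j0 : 'I_m) :
  is_interval I -> I s -> I t ->
  (forall j, {within I, continuous (a j)}) ->
  (forall j, 0 < a j s) -> a j0 t < 0 ->
  exists2 c, I c & (forall j, 0 <= a j c) /\ (exists j, a j c = 0).
Proof.
move=> II Is It ca as0 at0.
(* The default value 1 of the minimum only has to be positive. *)
pose g u := \big[Order.min/1]_j a j u.
have cg : {within I, continuous g}.
  move=> u; rewrite /g/=.
  apply: (@cvg_big R _ Order.min) => [|j _]; [exact: min_continuous|exact: ca].
have gs0 : 0 < g s by apply/bigmin_gtP; split=> // j _; exact: as0.
have gt0 : g t < 0 by apply: le_lt_trans at0; exact: bigmin_le.
have [c Ic gc0] : exists2 c, I c & g c = 0.
  have [st|/ltW ts] := leP s t.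
  - have sub : `[s, t] `<=` I by move=> u /=; rewrite in_itv/=; exact: II.
    have [|c cst gc] := @IVT _ g s t 0 st (continuous_subspaceW sub cg).
      by rewrite ge_min le_max (ltW gs0) (ltW gt0) orbT.
    by exists c => //; exact: sub.
  - have sub : `[t, s] `<=` I by move=> u /=; rewrite in_itv/=; exact: II.
    have [|c cst gc] := @IVT _ g t s 0 ts (continuous_subspaceW sub cg).
      by rewrite ge_min le_max (ltW gs0) (ltW gt0) orbT.
    by exists c => //; exact: sub.
exists c => //; split=> [j|].
  by rewrite -gc0; exact: bigmin_le.
apply: contrapT => /forallNP ac; suff : 0 < g c by rewrite gc0 ltxx.
have ac0 j : 0 < a j c.
  rewrite lt_neqAle eq_sym; apply/andP; split; first exact/eqP/ac.
  by rewrite -gc0; exact: bigmin_le.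
by apply/bigmin_gtP; split=> // j _; exact: ac0.
Qed.

(** Caratheodory's theorem stops at [n + 1] points; the continuity of [x] and
    the connectedness of [I] are what allows the descent to reach [n]. *)
Lemma zero_combination_exchange (R : realType) (I : set R) (n m : nat)
    (x : 'I_n -> R -> R) :
  is_interval I -> (forall k, {within I, continuous (x k)}) ->
  (n <= m)%N -> (0 < m)%N ->
  zero_combination I x 'I_m.+1 -> zero_combination I x 'I_m.
Proof.
move=> II cx nm m0 [p [w [Ip w0 w1 wx0]]].
have w_pos := exists_pos_weight w1.
have [[j wj0]|/forallNP wn0] := pselect (exists j, w j = 0).
  by apply: (@zero_combination_prune _ _ _ _ _ _ p w) => //; exists j.
have {w0 w1 wn0 w_pos}w0 j : 0 < w j.
  by rewrite lt_neqAle eq_sym w0 andbT; exact/eqP.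
pose A : 'M[R]_(m, n) := \matrix_(j, k) x k (p (lift ord0 j)).
have [fA|/negP nfA] := boolP (row_free A); last first.
  have [v vA v0] : exists2 v : 'rV_m, v *m A = 0 & v != 0.
    apply: contrapT => vN; apply: nfA; apply: inj_row_free => v vA.
    by apply: contrapT => /eqP v0; apply: vN; exists v.
  apply: (@zero_combination_dependent _ _ _ _ _ _ p w (v ord0)) => //.
    move=> k; have /matrixP/(_ ord0 k) := vA; rewrite !mxE => vAk.
    by rewrite -[RHS]vAk; apply: eq_bigr => j _; rewrite mxE.
  apply: contrapT => /forallNP vN; move/eqP: v0; apply; apply/rowP => j.
  by rewrite mxE; apply: contrapT => /eqP vj; apply: (vN j).
(* From here on [n = m], and the points other than the first form a basis. *)
have FA : row_full A.
  by rewrite /row_full eqn_leq rank_leq_col (leq_trans nm)// row_leq_rank.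
pose y t : 'rV[R]_n := \row_k x k t.
(* Coordinates of the curve in the basis opposite to the rows of [A]. *)
pose a j t := - (y t *m pinvmx A) ord0 j.
have aE t k : x k t + \sum_j a j t * x k (p (lift ord0 j)) = 0.
  have /matrixP/(_ ord0 k) : y t *m pinvmx A *m A = y t.
    by rewrite -mulmxA mulVpmx// mulmx1.
  rewrite mxE [in RHS]mxE => <-; rewrite -big_split/= big1// => j _.
  by rewrite /a [A _ _]mxE mulNr subrr.
have a_p i j : a i (p (lift ord0 j)) = - (j == i)%:R.
  have yE : y (p (lift ord0 j)) = row j A by apply/rowP => k; rewrite !mxE.
  by rewrite /a yE -row_mul mulmxVp// !mxE.
have a_p0 j : 0 < a j (p ord0).
  have : \sum_i w i *: y (p i) = 0.
    apply/rowP => k; rewrite summxE mxE -[RHS](wx0 k).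
    by apply: eq_bigr => i _; rewrite !mxE.
  move/(congr1 (fun v => - (v *m pinvmx A) ord0 j)).
  rewrite mulmx_suml summxE -sumrN mul0mx mxE oppr0.
  under eq_bigr do rewrite -scalemxAl mxE -mulrN.
  rewrite big_ord_recl/= -/(a j _).
  rewrite (eq_bigr (fun i => - (if i == j then w (lift ord0 j) else 0))); last first.
    move=> i _; rewrite -/(a j _) a_p mulrN.
    by have [->|_] := eqVneq; rewrite ?mulr1 ?mulr0.
  rewrite sumrN -big_mkcond/= big_pred1_eq => /eqP; rewrite subr_eq0 => /eqP wE.
  by rewrite -(pmulr_rgt0 _ (w0 ord0)) wE.
have ca j : {within I, continuous (a j)}.
  rewrite /a => t; apply: cvgN; under eq_fun do rewrite mxE.
  rewrite mxE; apply: cvg_big => [|k _]; first exact: add_continuous.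
  apply: cvgM; last exact: cvg_cst.
  by under eq_fun do rewrite mxE; rewrite mxE; exact: cx.
pose j0 := Ordinal m0.
have [|c Ic [ac0 [j acj]]] :=
    @common_zero_of_min R I m a (p ord0) (p (lift ord0 j0)) j0
      II (Ip _) (Ip _) ca a_p0.
  by rewrite a_p eqxx oppr_lt0.
apply: (@zero_combination_prune _ _ _ _ _ _
    (fun i => if unlift ord0 i is Some j then p (lift ord0 j) else c)
    (fun i => if unlift ord0 i is Some j then a j c else 1)).
- by move=> i; case: unliftP.
- by move=> i; case: unliftP.
- by exists ord0; rewrite unlift_none.
- move=> k; rewrite big_ord_recl unlift_none mul1r.
  by under eq_bigr do rewrite liftK; exact: aE.
- by exists (lift ord0 j); rewrite liftK.
Qed.

(** A family of fewer than [n] points is padded with zero weights. *)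
Lemma zero_combination_resize (R : realType) (I : set R) (n : nat)
    (x : 'I_n -> R -> R) (J : finType) :
  is_interval I -> (forall k, {within I, continuous (x k)}) -> (0 < n)%N ->
  zero_combination I x J -> zero_combination I x 'I_n.
Proof.
move=> II cx n0 [p [w [Ip w0 w1 wx0]]].
have I0 : I !=set0.
  have [j _|J0] := pickP (@predT J); first by exists (p j).
  by move: w1; rewrite big_pred0// => /esym/eqP; rewrite oner_eq0.
have {p w Ip w0 w1 wx0} : zero_combination I x 'I_#|J|.
  exists (p \o enum_val), (w \o enum_val); split => [i|i||k] /=.
  - exact: Ip.
  - exact: w0.
  - by rewrite -[RHS]w1 [RHS](reindex _ (onW_bij _ (@enum_val_bij J))).
  - by rewrite -[RHS](wx0 k) [RHS](reindex _ (onW_bij _ (@enum_val_bij J))).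
elim: #|J| => [|m IHm] H.
  case: H => p [w [_ _ w1 _]].
  by move: w1; rewrite big_ord0 => /esym/eqP; rewrite oner_eq0.
have [nm|mn] := leqP n m.
  apply: IHm; exact: (zero_combination_exchange II cx nm (leq_trans n0 nm)).
suff : forall d, zero_combination I x 'I_(m.+1 + d).
  by move/(_ (n - m.+1)%N); rewrite subnKC.
elim=> [|d IHd]; first by rewrite addn0.
by rewrite addnS; exact: zero_combination_pad.
Qed.

(** * Zero integrals put the origin in the convex hull *)

Lemma integrable_tensor (R : realType) (d1 d2 : measure_display)
    (T1 : measurableType d1) (T2 : measurableType d2)
    (m1 : {sigma_finite_measure set T1 -> \bar R})
    (m2 : {sigma_finite_measure set T2 -> \bar R})
    (A : set T1) (B : set T2) (u : T1 -> R) (v : T2 -> R) :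
  measurable A -> measurable B ->
  m1.-integrable A (EFin \o u) -> m2.-integrable B (EFin \o v) ->
  (m1 \x m2)%E.-integrable (A `*` B) (fun z => (u z.1 * v z.2)%:E) /\
  (\int[m1 \x m2]_(z in A `*` B) (u z.1 * v z.2)%:E =
   \int[m1]_(s in A) (u s)%:E * \int[m2]_(t in B) (v t)%:E)%E.
Proof.
move=> mA mB; have mAB : measurable (A `*` B) by exact: measurableX.
move=> iu iv.
have {}iu : m1.-integrable setT (EFin \o (u \_ A)).
  by rewrite -restrict_EFin; apply/(integrable_mkcond _ mA).
have {}iv : m2.-integrable setT (EFin \o (v \_ B)).
  by rewrite -restrict_EFin; apply/(integrable_mkcond _ mB).
pose h (z : T1 * T2) : \bar R := ((u \_ A) z.1 * (v \_ B) z.2)%:E.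
have uvE : (fun z => (u z.1 * v z.2)%:E) \_ (A `*` B) = h.
  apply/funext => -[s t]; rewrite /h !patchE/= in_setX/=.
  by case: (s \in A) => /=; case: (t \in B); rewrite ?(mulr0, mul0r).
have mh : measurable_fun setT h.
  apply/measurable_EFinP; apply: measurable_funM.
    apply: (measurableT_comp _ measurable_fst).
    by apply/measurable_EFinP; exact: measurable_int iu.
  apply: (measurableT_comp _ measurable_snd).
  by apply/measurable_EFinP; exact: measurable_int iv.
have iuv : (m1 \x m2)%E.-integrable setT h.
  apply/integrable12ltyP => //=.
  have iv' := integrable_norm iv.
  have cfin := integrable_fin_num measurableT iv'.
  rewrite (eq_integral (fun s =>
    (EFin \o (Num.norm \o (u \_ A))) s *
      (fine (\int[m2]_t (EFin \o (Num.norm \o (v \_ B))) t))%:E)%E); last first.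
    move=> s _; under eq_integral do rewrite normrM EFinM.
    by rewrite integralZl//= fineK.
  have iu' := integrable_norm iu.
  rewrite integralZr// ltey_eq fin_numM//. 
  exact: (integrable_fin_num measurableT iu').
split; first by apply/(integrable_mkcond _ mAB); rewrite uvE.
rewrite integral_mkcond uvE -integral12_prod_meas1//= /fubini_F/=.
rewrite [X in (X * _)%E]integral_mkcond [X in (_ * X)%E]integral_mkcond.
rewrite !restrict_EFin.
have cfin := integrable_fin_num measurableT iv.
transitivity (\int[m1]_s
  ((EFin \o (u \_ A)) s * (fine (\int[m2]_t (EFin \o (v \_ B)) t))%:E))%E.
  apply: eq_integral => s _; rewrite /h/=; under eq_integral do rewrite EFinM.
  by rewrite integralZl//= fineK.
by rewrite integralZr// fineK.
Qed.

Lemma ae_eq0_of_signed_integrals (R : realType) (d : measure_display)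
    (T : measurableType d) (mu : {measure set T -> \bar R}) (P N : set T)
    (f : T -> R) :
  measurable P -> measurable N -> [disjoint P & N] ->
  (forall t, P t -> 0 <= f t) -> (forall t, N t -> f t <= 0) ->
  mu.-integrable (P `|` N) (EFin \o f) ->
  (\int[mu]_(t in P) (f t)%:E = 0)%E -> (\int[mu]_(t in N) (f t)%:E = 0)%E ->
  ae_eq mu (P `|` N) (EFin \o f) (cst 0%E).
Proof.
move=> mP mN PN f_ge0 f_le0 if_ fP fN.
have mPN : measurable (P `|` N) by exact: measurableU.
have mf := measurable_int mu if_.
apply/(ae_eq_integral_abs mu mPN mf).
rewrite integral_setU//; last exact: measurableT_comp.
rewrite (eq_integral (EFin \o f)); last first.
  by move=> t /[!inE] Pt /=; rewrite ger0_norm// f_ge0.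
rewrite [X in (_ + X)%E](_ : _ = \int[mu]_(t in N) ((-1)%:E * (f t)%:E))%E; last first.
  apply: eq_integral => t /[!inE] Nt /=.
  by rewrite ler0_norm ?f_le0// -EFinM mulN1r.
rewrite integralZl// ?fP ?fN ?mule0 ?adde0//.
by apply: integrableS if_ => //; exact: subsetUr.
Qed.

Lemma fin_num_product_measure (R : realType) (d1 d2 : measure_display)
    (T1 : measurableType d1) (T2 : measurableType d2)
    (m1 : {finite_measure set T1 -> \bar R})
    (m2 : {finite_measure set T2 -> \bar R}) :
  fin_num_fun (m1 \x m2)%E.
Proof.
move=> U mU; rewrite ge0_fin_numE ?measure_ge0//.
have UT : ((m1 \x m2) U <= (m1 \x m2) (setT `*` setT))%E.
  by apply: le_measure; rewrite ?inE ?setXTT.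
by rewrite (le_lt_trans UT)// product_measure1E// ltey_eq fin_numM ?fin_num_measure.
Qed.

(** The measurable space is quantified after [n] because the induction passes
    from [T] to [T * T]; [D] varies as well, since it is cut down to the zero
    set of a function when that function vanishes almost everywhere. *)
Lemma zero_combination_of_integral_eq0 (R : realType) (n : nat) :
  forall (d : measure_display) (T : measurableType d)
    (mu : {finite_measure set T -> \bar R}) (D : set T)
    (x : 'I_n -> T -> R),
  measurable D -> (0 < mu D)%E ->
  (forall k, mu.-integrable D (EFin \o x k)) ->
  (forall k, \int[mu]_(t in D) (x k t)%:E = 0)%E ->
  exists J : finType, zero_combination D x J.
Proof.
elim: n => [|n IHn] d T mu D x mD D0 ix x0.
  have [t Dt] : D !=set0.
    by apply/set0P; apply: contraTneq D0 => ->; rewrite measure0 ltxx.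
  exists unit, (fun=> t), (fun=> 1); split=> // [|[]//].
  by rewrite big_const cardT enumT unlock /= addr0.
pose f := x ord0; pose y k := x (lift ord0 k).
have if_ : mu.-integrable D (EFin \o f) := ix ord0.
have mf : measurable_fun D f.
  by apply/measurable_EFinP; exact: measurable_int if_.
pose P := D `&` [set t | 0 <= f t]; pose N := D `&` [set t | f t < 0].
have mP : measurable P by apply: measurable_fun_le => //; exact: measurable_cst.
have PNE : D = P `|` N.
  by rewrite -setIUr; apply/esym/setIidPl => t _ /=; case: leP; [left|right].
have PN0 : [disjoint P & N].
  by apply/disj_setPS => t [[_ /= ft0] [_ /=]]; rewrite ltNge ft0.
have mN : measurable N.
  have -> : N = D `\` P; last exact: measurableD.
  rewrite PNE setDUl setDv set0U; apply/esym/setDidPl.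
  by rewrite setIC; exact/eqP/PN0.
have PD : P `<=` D by move=> t [].
have ND : N `<=` D by move=> t [].
have iP k : mu.-integrable P (EFin \o x k) by exact: integrableS (ix k).
have iN k : mu.-integrable N (EFin \o x k) by exact: integrableS (ix k).
pose a k := fine (\int[mu]_(t in P) (x k t)%:E).
pose b k := fine (\int[mu]_(t in N) (x k t)%:E).
have aE k : (\int[mu]_(t in P) (x k t)%:E = (a k)%:E)%E.
  by rewrite fineK//; exact: integrable_fin_num (iP k).
have bE k : (\int[mu]_(t in N) (x k t)%:E = (b k)%:E)%E.
  by rewrite fineK//; exact: integrable_fin_num (iN k).
have baE k : b k = - a k.
  apply/eqP; rewrite -addr_eq0 addrC -eqe EFinD -aE -bE -integral_setU//.
    by rewrite -PNE x0.
  by rewrite -PNE; exact: measurable_int (ix k).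
(* Either [f] is zero almost everywhere, or [P] and [N] both have positive
   measure. *)
have [a0|a0] := eqVneq (a ord0) 0.
  have f_ae : ae_eq mu D (EFin \o f) (cst 0%E).
    rewrite PNE; apply: ae_eq0_of_signed_integrals => //.
    - by move=> t [].
    - by move=> t [_ /ltW].
    - by rewrite -PNE.
    - by rewrite aE a0.
    - by rewrite bE baE a0 oppr0.
  pose Z := D `&` [set t | (f t)%:E = 0%E].
  have mZ : measurable Z.
    by apply: measurable_eqe => //; exact: measurable_int if_.
  have mDZ : measurable (D `\` Z) by exact: measurableD.
  have DZ0 : mu (D `\` Z) = 0%E.
    apply: measure_negligible => //; apply: negligibleS f_ae => t [Dt nZ] /= ft.
    by apply: nZ; split => //; exact: ft.
  have DDZ : D `\` (D `\` Z) = Z by rewrite setDD setIA setIid.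
  have [||k|k|J [p [w [Zp w0 w1 wy0]]]] := IHn d T mu Z y.
  - exact: mZ.
  - have := measureDI mu mD mZ; rewrite [X in (X + _)%E](_ : _ = 0%E)//.
    by rewrite add0e /Z setIA setIid => <-.
  - by apply: integrableS (ix (lift ord0 k)) => // t [].
  - by rewrite -DDZ -negligible_integral//; [exact: x0|exact: ix].
  exists J, p, w; split => // [j|k]; first by have [] := Zp j.
  have [k' ->|->] := unliftP ord0 k; first exact: wy0.
  by rewrite big1// => j _; have [_ [fp]] := Zp j; rewrite -/f fp mulr0.
have P0 : (0 < mu P)%E.
  rewrite lt_neqAle measure_ge0 andbT eq_sym; apply: contra_neq a0 => P0.
  by rewrite /a null_set_integral//; exact: measurable_int (iP ord0).
have N0 : (0 < mu N)%E.
  rewrite lt_neqAle measure_ge0 andbT eq_sym; apply: contra_neq a0 => N0.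
  apply/eqP; rewrite -oppr_eq0 -baE; apply/eqP.
  by rewrite /b null_set_integral//; exact: measurable_int (iN ord0).
have mPN : measurable (P `*` N) by exact: measurableX.
(* The values at [z.1] and [z.2], with the nonnegative weights [- f z.2]
   and [f z.1] that cancel the coordinate [f]. *)
pose q k (z : T * T) := f z.1 * y k z.2 - y k z.1 * f z.2.
pose mu2 : {finite_measure set (T * T)%type -> \bar R} :=
  HB.pack (mu \x mu)%E (Measure_isFinite.Build _ _ _ (mu \x mu)%E
    (fin_num_product_measure mu mu)).
have [||k|k|J [p [w [PNp w0 w1 wq0]]]] := IHn _ _ mu2 (P `*` N) q.
- by [].
- have -> : mu2 (P `*` N) = (mu P * mu N)%E by exact: product_measure1E.
  exact: mule_gt0.
- have [iq1 _] := integrable_tensor mP mN (iP ord0) (iN (lift ord0 k)).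
  have [iq2 _] := integrable_tensor mP mN (iP (lift ord0 k)) (iN ord0).
  exact: integrableB iq1 iq2.
- have [iq1 eq1] := integrable_tensor mP mN (iP ord0) (iN (lift ord0 k)).
  have [iq2 eq2] := integrable_tensor mP mN (iP (lift ord0 k)) (iN ord0).
  under eq_integral do rewrite EFinB.
  rewrite integralB_EFin// eq1 eq2 !aE !bE !baE -!EFinM -EFinB.
  by rewrite !mulrN mulrC subrr.
exists (J + J)%type.
apply: (@zero_combination_normalize _ _ _ _ _ _
  (fun i => match i with inl j => (p j).1 | inr j => (p j).2 end)
  (fun i => match i with
            | inl j => w j * - f (p j).2
            | inr j => w j * f (p j).1 end)).
- by case=> j; have [] := PNp j => [[? _] [? _]].
- case=> j; have [[_ /= fp1] [_ /= fp2]] := PNp j; apply: mulr_ge0 => //.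
  by rewrite oppr_ge0 ltW.
- have [j wj] := exists_pos_weight w1.
  have [[_ /= fp1] [_ /= fp2]] := PNp j.
  by exists (inl j); rewrite mulr_gt0// oppr_gt0.
- move=> k; rewrite big_sumType/= -big_split/=.
  have [k' ->|->] := unliftP ord0 k.
    rewrite -[RHS](wq0 k'); apply: eq_bigr => j _; rewrite /q /y; ring.
  by rewrite big1// => j _; rewrite /f; ring.
Qed.

Lemma zero_combination_of_restricted_integral_eq0 (R : realType)
    (d : measure_display) (T : measurableType d)
    (mu : {measure set T -> \bar R}) (D : set T) (n : nat)
    (x : 'I_n -> T -> R) :
  measurable D -> (0 < mu D < +oo)%E ->
  (forall k, mu.-integrable D (EFin \o x k)) ->
  (forall k, \int[mu]_(t in D) (x k t)%:E = 0)%E ->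
  exists J : finType, zero_combination D x J.
Proof.
move=> mD /andP[D0 Doo] ix x0.
have nuE A : measurable A -> A `<=` D -> mfrestr mD Doo A = mu A.
  by move=> mA AD; rewrite /mfrestr /mrestr setIidl.
apply: (@zero_combination_of_integral_eq0 _ _ _ _ (mfrestr mD Doo)) => //.
- by move: D0; rewrite -(nuE _ mD (@subset_refl _ D)).
- move=> k; have /integrableP[mx xoo] := ix k; apply/integrableP; split=> //.
  by rewrite (eq_measure_integral mu).
- by move=> k; rewrite (eq_measure_integral mu).
Qed.

(** * Quadrature with as many nodes as functions *)

Theorem theorem2 (R : realType) (I : set R) (hI : is_interval I)
    (hI0 : I !=set0)
    (mu : {measure set (measurableTypeR R) -> \bar R})
    (hmu : (mu I < +oo)%E)
    (n : nat) (hn : (1 <= n)%N)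
    (x : 'I_n -> R -> R)
    (hcont : forall k : 'I_n, {within I, continuous (x k)})
    (hint : forall k : 'I_n, mu.-integrable I (fun t => (x k t)%:E)) :
  exists (t : 'I_n -> R) (lambda : 'I_n -> R),
    [/\ forall i : 'I_n, I (t i),
        forall i : 'I_n, 0 <= lambda i,
        (\sum_(i < n) lambda i)%:E = mu I &
        forall k : 'I_n,
          (\int[mu]_(s in I) (x k s)%:E)%E =
          (\sum_(i < n) lambda i * x k (t i))%:E].
Proof.
have mI : measurable (I : set (measurableTypeR R)).
  exact: is_interval_measurable.
have [muI0|muI0] := eqVneq (mu I) 0%E.
  have [t0 It0] := hI0; exists (fun=> t0), (fun=> 0); split => // [|k].
    by rewrite big1.
  rewrite big1 => [|i _]; last by rewrite mul0r.
  by rewrite null_set_integral//; exact: measurable_int (hint k).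
pose M := fine (mu I); have ME : mu I = M%:E by rewrite fineK// ge0_fin_numE.
have M0 : 0 < M by rewrite -lte_fin -ME lt_neqAle eq_sym muI0 measure_ge0.
pose m k := fine (\int[mu]_(s in I) (x k s)%:E)%E.
have mE k : (\int[mu]_(s in I) (x k s)%:E = (m k)%:E)%E.
  by rewrite fineK//; exact: integrable_fin_num (hint k).
pose z k s := x k s - m k / M.
have icst k : mu.-integrable I (EFin \o cst (m k / M)).
  apply/integrableP; split.
    by apply/measurable_EFinP; exact: measurable_cst.
  by rewrite [ltLHS](integral_cst mu mI `|m k / M|%:E) ME -EFinM ltry.
have iz k : mu.-integrable I (EFin \o z k).
  exact: integrableB (hint k) (icst k).
have intz k : (\int[mu]_(s in I) (z k s)%:E = 0)%E.
  under eq_integral do rewrite EFinB.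
  rewrite integralB_EFin//; [|exact: hint|exact: icst].
  rewrite mE [X in (_ - X)%E](integral_cst mu mI (m k / M)%:E) ME -EFinM -EFinB.
  by rewrite divfK ?subrr// gt_eqF.
have cz k : {within I, continuous (z k)}.
  by move=> s; apply: cvgB; [exact: hcont|exact: cvg_cst].
have I0oo : (0 < mu I < +oo)%E by rewrite hmu ME lte_fin M0.
have [J /(zero_combination_resize hI cz hn)[t [w [It w0 w1 wz0]]]] :=
  zero_combination_of_restricted_integral_eq0 mI I0oo iz intz.
exists t, (fun i => M * w i); split => // [i||k].
- by rewrite mulr_ge0// ltW.
- by rewrite -mulr_sumr w1 mulr1 ME.
- have xE : \sum_i w i * x k (t i) = m k / M.
    have := wz0 k; under eq_bigr do rewrite mulrBr.
    by rewrite sumrB -mulr_suml w1 mul1r => /eqP; rewrite subr_eq0 => /eqP.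
  rewrite mE; under eq_bigr do rewrite -mulrA.
  by rewrite -mulr_sumr xE mulrC divfK// gt_eqF.
Qed.
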